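(* Let $a,b>0$, let $\{\xi_i\}_{i\ge-1}$ be i.i.d. with density $\phi=(a+b)^{-1}\mathbf{1}_{(-a,b)}$ (uniform on $(-a,b)$), and let $Z_i:=\xi_i+\xi_{i-1}$ for $i\ge0$ (the MA(1) process with $a_1=1$). (1) If $a\ge b$, then $$\mathbb{P}\Big(\min_{0\le i\le n}Z_i\ge0\Big)=\Big(\frac{4b}{\pi(a+b)}\Big)^{n+o(n)}\quad(n\to\infty).$$ (2) If $a<b$, then $$\mathbb{P}\Big(\min_{0\le i\le n}Z_i\ge0\Big)=\lambda^{n+o(n)}\quad(n\to\infty),$$ where $\lambda$ is the largest real solution of the equation $$\tan\Big(\frac{a}{(a+b)\lambda}\Big)=\frac{1-\big(1-\frac{2a}{a+b}\big)/\lambda}{1+\big(1-\frac{2a}{a+b}\big)/\lambda}.$$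
   Context: The notation $p_n=\lambda^{n+o(n)}$ with $\lambda\in(0,1)$ means $\lim_{n\to\infty}\frac1n\log p_n=\log\lambda$. *)

(* Defs.v *)
From mathcomp Require Export all_boot all_order all_algebra.
From mathcomp Require Export all_classical all_reals all_analysis.
Export Order.TTheory GRing.Theory Num.Theory.
Export numFieldNormedType.Exports.

Set Implicit Arguments.
Unset Strict Implicit.
Unset Printing Implicit Defensive.

Local Open Scope classical_set_scope.
Local Open Scope ring_scope.

Definition has_density d (T : measurableType d) (R : realType)
    (P : probability T R) (X : {RV P >-> R}) (f : R -> R) : Prop :=
  forall A : set R, measurable A ->
    distribution P X A = (\int[lebesgue_measure]_(x in A) (f x)%:E)%E.

Definition mutually_independent d (T : measurableType d) (R : realType)
    (P : probability T R) (X : nat -> {RV P >-> R}) : Prop :=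
  forall (J : seq nat) (A : nat -> set R),
    uniq J -> (forall i, measurable (A i)) ->
    P [set w | forall i, i \in J -> A i (X i w)]
      = (\prod_(i <- J) P (X i @^-1` A i))%E.

(* Independent with common density [f]; this is i.i.d. since the density
   determines the law. *)
Definition iid_with_density d (T : measurableType d) (R : realType)
    (P : probability T R) (X : nat -> {RV P >-> R}) (f : R -> R) : Prop :=
  mutually_independent X /\ forall i, has_density (X i) f.

Definition phi (R : realType) (a b : R) : R -> R :=
  fun x => (a + b)^-1 * \1_(`](- a), b[ : set R) x.

(* The innovations are indexed from -1 in the mathematics: here [xi k] stands
   for the innovation of index k - 1, so Z_i = xi_i + xi_(i-1) reads
   [xi i.+1 + xi i]. *)
Definition ma1 d (T : measurableType d) (R : realType) (P : probability T R)
    (xi : nat -> {RV P >-> R}) (i : nat) (w : T) : R :=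
  xi i.+1 w + xi i w.

(* The minimum of Z_0, ..., Z_n; the starting value Z_0 of the iterated minimum
   is one of the terms, hence harmless. *)
Definition running_min T (R : realType) (Z : nat -> T -> R) (n : nat) (w : T)
    : R :=
  \big[Num.min/Z 0%N w]_(i < n.+1) Z i w.

Definition persistence_prob d (T : measurableType d) (R : realType)
    (P : probability T R) (xi : nat -> {RV P >-> R}) (n : nat) : R :=
  fine (P [set w | 0 <= running_min (ma1 xi) n w]).

(* p_n = lambda^(n + o(n)).  The library sets ln 0 = 0, but as ln lambda < 0 the
   convergence still forces p_n > 0 for n large when p_n >= 0. *)
Definition exponential_rate (R : realType) (p : nat -> R) (lambda : R) : Prop :=
  0 < lambda < 1 /\ (n%:R^-1 * ln (p n) @[n --> \oo] --> ln lambda).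

(* Division by zero is total in the library (and [tan] is 0 at its poles), so
   a solution is required to be a point where both sides are defined. *)
Definition eigen_solution (R : realType) (a b lambda : R) : Prop :=
  let r := 1 - 2 * a / (a + b) in
  [/\ lambda != 0,
      cos (a / ((a + b) * lambda)) != 0,
      1 + r / lambda != 0
    & tan (a / ((a + b) * lambda)) = (1 - r / lambda) / (1 + r / lambda)].

Definition largest_eigen_solution (R : realType) (a b lambda : R) : Prop :=
  eigen_solution a b lambda /\
  forall mu : R, eigen_solution a b mu -> mu <= lambda.

(* Main.v *)
(* Conditioning on the past, survival is governed by the positive operator
   K f(x) = (a + b)^-1 * int_{y in (-a, b), x + y >= 0} f(y) dy on (-a, b).
   Differentiating K f = lam f twice gives f'' = - c^2 f with
   c = 1 / ((a + b) lam), whence the eigenfunction cos (c y) + sin (c y) on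
   [-m, m], m = min(a, b), extended by constants outside; the only remaining
   condition is f(-m) = c (b - m) f(m), that is c = pi / (4 b) if a >= b, and the
   equation of the statement if a < b.  As c m <= pi / 4, f is nonnegative.
   With S_n = "xi_0, ..., xi_n in (-a, b) and Z_0, ..., Z_(n-1) >= 0", the
   weights M_n = E[1_{S_n} f(xi_n)] satisfy M_(n+1) = lam M_n.  Moreover
   f <= 2 gives M_n <= 2 P(S_n), while f >= 1 on the nonnegative reals and the
   fact that one of two reals with nonnegative sum is nonnegative give
   P(S_(n+1)) <= M_(n+1) + M_n. *)
From HB Require Import structures.
Require Import Defs.
From mathcomp Require Import measurable_realfun ring lra.

Set Implicit Arguments.
Unset Strict Implicit.
Unset Printing Implicit Defensive.

Local Open Scope classical_set_scope.
Local Open Scope ring_scope.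

(** * Elementary inequalities for sine and cosine *)

Section trigonometry.
Context (R : realType).

Lemma sin_le_cos (t : R) : 0 <= t <= pi / 4 -> 0 <= sin t <= cos t.
Proof.
move=> /andP[t0 t4]; have p0 := pi_gt0 R.
have s0 : 0 <= sin t by apply: sin_ge0_pi; rewrite t0/=; lra.
rewrite s0/=.
have -> : cos t = sin (pi / 2 - t).
  by rewrite sinB sin_pihalf cos_pihalf mul0r subr0 mul1r.
rewrite leNgt ltr_sin ?in_itv/= -?leNgt; try (apply/andP; split); lra.
Qed.

(** The square of [cos t + sin t] is [1 + 2 * cos t * sin t], and both factors are nonnegative
    here. *)
Lemma le1_cosDsin (t : R) : 0 <= t <= pi / 4 -> 1 <= cos t + sin t.
Proof. by move=> /sin_le_cos/andP[s0 sc]; have := cos2Dsin2 t; nra. Qed.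

Lemma cos_piquarter : cos (pi / 4) = sin (pi / 4) :> R.
Proof.
have -> : cos (pi / 4) = sin (pi / 2 - pi / 4) :> R.
  by rewrite sinB sin_pihalf cos_pihalf mul0r subr0 mul1r.
by congr sin; field.
Qed.

Lemma lt1_cosDsin (t : R) : 0 < t <= pi / 4 -> 1 < cos t + sin t.
Proof.
move=> /andP[t0 t4]; have p0 := pi_gt0 R.
have s0 : 0 < sin t by apply: sin_gt0_pi; rewrite t0/=; lra.
have /andP[_ sc] : 0 <= sin t <= cos t by apply: sin_le_cos; rewrite ltW.
by have := cos2Dsin2 t; nra.
Qed.

Lemma sin_le (t : R) : 0 <= t -> sin t <= t.
Proof.
move=> t0; have [x _] := @MVT_segment R (@sin R) (@cos R) 0 t t0
  (fun x _ => is_derive_sin x) (continuous_subspaceT (@continuous_sin R)).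
by rewrite sin0 !subr0 => ->; rewrite ler_piMl// cos_le1.
Qed.

End trigonometry.

(** * The eigenfunction and its integral equation *)

Section eigenfunction.
Context (R : realType) (c m : R).

Definition trig_sum (t : R) : R := cos (c * t) + sin (c * t).

(** For [0 < m] this is the projection onto [[- m, m]]; composing with it extends [trig_sum] by its
    boundary values. *)
Definition clamp (y : R) : R := Num.max (- m) (Num.min m y).

Definition eigf (y : R) : R := trig_sum (clamp y).

Lemma clamp_itv y : 0 < m -> - m <= clamp y <= m.
Proof.
move=> m0; rewrite /clamp le_max ge_max ge_min !lexx/= andbT.
by rewrite ge0_cp// ltW.
Qed.

Lemma clamp_id y : - m <= y <= m -> clamp y = y.
Proof. by move=> /andP[h1 h2]; rewrite /clamp (min_r h2) (max_r h1). Qed.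

Lemma clamp_ge y : 0 < m -> m <= y -> clamp y = m.
Proof. by move=> m0 h; rewrite /clamp (min_l h) max_r//; lra. Qed.

Lemma clamp_le y : 0 < m -> y <= - m -> clamp y = - m.
Proof.
move=> m0 h; have ym : y <= m by lra.
by rewrite /clamp (min_r ym) (max_l h).
Qed.

Lemma trig_sum_ge1 t : 0 < c -> c * m <= pi / 4 -> 0 <= t <= m -> 1 <= trig_sum t.
Proof.
move=> c0 cm /andP[t0 tm]; apply: le1_cosDsin.
by rewrite mulr_ge0 ?(ltW c0)//= (le_trans _ cm)// ler_pM2l.
Qed.

Lemma trig_sum_ge0 t : 0 < c -> c * m <= pi / 4 -> - m <= t <= m -> 0 <= trig_sum t.
Proof.
move=> c0 cm /andP[tm1 tm2]; have [t0|t0] := leP 0 t.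
  by apply: (le_trans ler01); apply: trig_sum_ge1; rewrite ?t0.
have : 0 <= c * - t <= pi / 4.
  rewrite mulr_ge0 ?(ltW c0)//= ?oppr_ge0 ?(ltW t0)//.
  by rewrite (le_trans _ cm)// ler_pM2l// lerNl.
by move=> /sin_le_cos; rewrite /trig_sum mulrN sinN cosN; lra.
Qed.

Lemma eigf_ge0 y : 0 < c -> 0 < m -> c * m <= pi / 4 -> 0 <= eigf y.
Proof. by move=> c0 m0 cm; apply: trig_sum_ge0 => //; exact: clamp_itv. Qed.

Lemma eigf_ge1 y : 0 < c -> 0 < m -> c * m <= pi / 4 -> 0 <= y -> 1 <= eigf y.
Proof.
move=> c0 m0 cm y0; apply: trig_sum_ge1 => //; have [ym|ym] := leP m y.
  by rewrite clamp_ge// lexx ltW.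
by rewrite clamp_id; lra.
Qed.

Lemma eigf_le2 y : eigf y <= 2.
Proof.
rewrite /eigf /trig_sum.
by have := cos_le1 (c * clamp y); have := sin_le1 (c * clamp y); lra.
Qed.

Lemma continuous_trig_sum : continuous trig_sum.
Proof.
move=> t; apply: (@continuousD _ R^o R^o (fun t => cos (c * t)) (fun t => sin (c * t))).
  apply: (@continuous_comp _ _ _ (fun t => c * t) (@cos R)); last exact: continuous_cos.
  exact: mulrl_continuous.
apply: (@continuous_comp _ _ _ (fun t => c * t) (@sin R)); last exact: continuous_sin.
exact: mulrl_continuous.
Qed.

Lemma measurable_eigf : measurable_fun setT eigf.
Proof.
apply: measurableT_comp; first exact: continuous_measurable_fun continuous_trig_sum.
by apply: measurable_maxr => //; apply: measurable_minr.
Qed.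

(** The reflected function [trig_sum (- t)] has derivative [- c * trig_sum t], so
    [- trig_sum (- t) / c] is an antiderivative of [trig_sum t]. *)
Lemma integral_trig_sum l : 0 < c -> - m <= l <= m ->
  (\int[lebesgue_measure]_(y in `[l, m]) (trig_sum y)%:E =
   ((trig_sum (- l) - trig_sum (- m)) / c)%:E)%E.
Proof.
move=> c0 /andP[lm1]; rewrite le_eqVlt => /predU1P[->|lm].
  by rewrite set_itv1 integral_set1 subrr mul0r.
pose G t := - (trig_sum (- t) / c).
have dG (t : R) : is_derive t 1 G (trig_sum t).
  have dc : is_derive t 1 (c \*: (@id R)) c.
    by apply: is_derive_eq; rewrite /GRing.scale/= mulr1.
  have -> : G = c^-1 \*: (@sin R \o (c \*: id)) - c^-1 \*: (@cos R \o (c \*: id)).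
    apply/funext => s; rewrite /G /trig_sum mulrN cosN sinN.
    transitivity (c^-1 * sin (c * s) - c^-1 * cos (c * s)); last by [].
    by ring.
  apply: is_derive_eq; rewrite /trig_sum /GRing.scale/=.
  by field; rewrite gt_eqF.
rewrite (@continuous_FTC2 _ _ G)//.
- by rewrite /G -EFinB; congr EFin; ring.
- by apply: continuous_subspaceT; exact: continuous_trig_sum.
- split=> [t _||].
  + by have [] := dG t.
  + apply: cvg_at_right_filter; apply: differentiable_continuous.
    by apply/derivable1_diffP; have [] := dG l.
  + apply: cvg_at_left_filter; apply: differentiable_continuous.
    by apply/derivable1_diffP; have [] := dG m.
- by move=> t _; rewrite derive1E derive_val.
Qed.

(** Let [k] and [s] be the cosine and sine of [c * m]. From [s <= c * m] and [1 < k + s] follows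
    [s < c * m * (k + s)]; adding twice this to the boundary condition
    [k - s = c * (b - m) * (k + s)] gives the claim multiplied by [k + s]. *)
Lemma eigenvalue_lt1 b : 0 < c -> 0 < m -> c * m <= pi / 4 ->
  trig_sum (- m) = c * (b - m) * trig_sum m -> 1 < c * (b + m).
Proof.
move=> c0 m0 cm; rewrite /trig_sum mulrN cosN sinN.
have t0 : 0 < c * m by exact: mulr_gt0.
have h1 : 1 < cos (c * m) + sin (c * m) by apply: lt1_cosDsin; rewrite t0.
have h2 := sin_le (ltW t0).
set k := cos _ in h1 *; set s := sin _ in h1 h2 * => e.
have h3 : s < c * m * (k + s).
  by rewrite (le_lt_trans h2)// -[ltLHS]mulr1 ltr_pM2l.
have ks0 : 0 < k + s by rewrite (lt_trans _ h1).
rewrite -(ltr_pM2r ks0).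
have -> : c * (b + m) * (k + s) = c * (b - m) * (k + s) + 2 * (c * m * (k + s)) by ring.
by rewrite -e; lra.
Qed.

(** The eigenvalue equation. With [l = - clamp x], the part over [[l, m]] is
    [(trig_sum (- l) - trig_sum (- m)) / c], the constant part beyond [m] is [(b - m) * trig_sum m],
    and [bnd] makes everything but [trig_sum (- l) / c] cancel. *)
Lemma eigf_integral a b x : 0 < c -> 0 < m -> c * m <= pi / 4 ->
  m <= a -> m <= b -> m = a \/ m = b ->
  trig_sum (- m) = c * (b - m) * trig_sum m -> - a < x < b ->
  (\int[lebesgue_measure]_(y in `](- a)%R, b[)
     (\1_(`[0%R, +oo[ : set R) (x + y) * eigf y)%:E = (eigf x / c)%:E)%E.
Proof.
move=> c0 m0 cm ma mb mE bnd /andP[ax xb].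
(* Integration starts at [- clamp x] in every case: [m <= x] forces [m = a], and the lower bound is
   [- a]; [x <= - m] forces [m = b], and the domain is empty. *)
pose l := - clamp x.
have /andP[l1 l2] : - m <= l <= m.
  by have := clamp_itv x m0; rewrite /l; lra.
pose S := `](- a), b[ `&` `[(- x), +oo[ : set R.
(* Whether the endpoint [l] belongs to [S] depends on the case, so this null set is removed
   first. *)
have SE : S `\ l = `]l, b[%classic.
  rewrite eqEsubset /S; split => y /=; rewrite !in_itv/= ?andbT.
    move=> [[/andP[ay yb] xy] /eqP yl]; rewrite yb andbT lt_neqAle eq_sym yl/=.
    rewrite /l; have [h|h] := leP m x.
      rewrite clamp_ge//; lra.
    have [h'|h'] := leP x (- m); first by rewrite clamp_le//; lra.
    by rewrite clamp_id; lra.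
  rewrite /l => /andP[ly yb]; split; last by apply/eqP; rewrite gt_eqF.
  have [h|h] := leP m x.
    by move: ly; rewrite clamp_ge//; lra.
  have [h'|h'] := leP x (- m); first by move: ly; rewrite clamp_le//; lra.
  by move: ly; rewrite clamp_id; lra.
have mf : measurable_fun setT (EFin \o eigf).
  by apply/measurable_EFinP; exact: measurable_eigf.
transitivity (\int[lebesgue_measure]_(y in S) (eigf y)%:E)%E.
  rewrite [RHS]integral_mkcondr; apply: eq_integral => y _.
  have -> : \1_(`[0, +oo[ : set R) (x + y) = (y \in [set` `[- x, +oo[])%:R :> R.
    rewrite indicE; congr ((nat_of_bool _)%:R).
    by apply/idP/idP; rewrite !inE/= !in_itv/= !andbT; lra.
  by rewrite patchE; case: ifPn; rewrite (mul0r, mul1r).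
have mS : measurable (S `\ l) by rewrite SE.
rewrite -(@integral_setD1 _ _ l)//; last exact: measurable_funTS.
rewrite SE -(@integral_itv_bndoo _ l b _ true false)//; last exact: measurable_funTS.
rewrite (@itv_bndbnd_setU _ _ (BLeft l) (BLeft m) (BRight b)) ?bnd_simp//.
rewrite ge0_integral_setU//=; last 3 first.
- exact: measurable_funTS.
- by move=> y _; rewrite lee_fin; exact: eigf_ge0.
- apply/disj_setPS => y /= []; rewrite !in_itv/= => /andP[_ ym] /andP[my _].
  by move: ym; rewrite ltNge my.
rewrite integral_itv_bndo_bndc; last exact: measurable_funTS.
have -> : (\int[lebesgue_measure]_(y in `[l, m]) (eigf y)%:E =
    \int[lebesgue_measure]_(y in `[l, m]) (trig_sum y)%:E)%E.
  apply: eq_integral => y; rewrite inE/= in_itv/= => /andP[ly ym].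
  by rewrite /eigf clamp_id// ym (le_trans l1).
have -> : (\int[lebesgue_measure]_(y in `[m, b]) (eigf y)%:E =
    \int[lebesgue_measure]_(y in `[m, b]) (trig_sum m)%:E)%E.
  apply: eq_integral => y; rewrite inE/= in_itv/= => /andP[my _].
  by rewrite /eigf clamp_ge.
rewrite integral_trig_sum ?l1//.
rewrite integral_cst//= lebesgue_measure_itv/= lte_fin.
rewrite (_ : (if _ then _ else _) = (b - m)%:E); last first.
  case: ltP => [//|bm]; have -> : b = m by apply: le_anti; rewrite bm mb.
  by rewrite subrr.
rewrite -EFinM -EFinD; congr EFin.
rewrite bnd /l opprK -/(eigf x).
by field; rewrite gt_eqF.
Qed.

End eigenfunction.

(** * Conditioning on the past of the innovations *)

Section innovations.
Context (R : realType) (d : measure_display) (T : measurableType d).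
Context (P : probability T R).

(** A family stable under intersection that generates the sigma-algebra of [xi 0], ..., [xi n], the
    past at time [n]. *)
Definition cylinders (xi : nat -> {RV P >-> R}) (n : nat) : set (set T) :=
  [set C | exists2 A : nat -> set R, (forall i, measurable (A i)) &
     C = [set w | forall i, (i <= n)%N -> A i (xi i w)]].

Lemma measurable_rv_preimage (X : {RV P >-> R}) (A : set R) :
  measurable A -> measurable (X @^-1` A).
Proof. by move=> mA; rewrite -[X in measurable X]setTI; exact: measurable_funP. Qed.

Lemma measurable_cylinders (xi : nat -> {RV P >-> R}) n :
  cylinders xi n `<=` measurable.
Proof.
move=> _ [A mA ->].
have -> : [set w | forall i, (i <= n)%N -> A i (xi i w)] =
    \bigcap_(i in `I_n.+1) (xi i @^-1` A i).
  by rewrite eqEsubset; split=> w /= h i ih; exact: h.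
by apply: bigcap_measurable => [|i _]; [exists 0%N|exact: measurable_rv_preimage].
Qed.

(** Both sides are finite measures in [E], so it suffices that they agree on the cylinders, a
    generating family stable under intersection. *)
Lemma past_indep (xi : nat -> {RV P >-> R}) n (E : set T) (B : set R) :
  mutually_independent xi -> <<s cylinders xi n>> E -> measurable B ->
  (P (E `&` xi n.+1 @^-1` B) = P E * P (xi n.+1 @^-1` B))%E.
Proof.
move=> ind sE mB.
have mXB := measurable_rv_preimage (xi n.+1) mB.
have cE : P (xi n.+1 @^-1` B) = (fine (P (xi n.+1 @^-1` B)))%:E.
  by rewrite fineK// fin_num_measure.
have c0 : 0 <= fine (P (xi n.+1 @^-1` B)) by exact: fine_ge0.
pose m1 := mrestr P mXB.
pose m2 := mscale (NngNum c0) P.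
have m2E F : m2 F = (P F * P (xi n.+1 @^-1` B))%E by rewrite cE muleC.
suff /(_ E sE) : forall F, <<s cylinders xi n>> F -> m1 F = m2 F.
  by rewrite m2E.
apply: (g_sigma_algebra_measure_unique (cylinders xi n)
  (@measurable_cylinders xi n) (fun=> setT)).
- by move=> _; exists (fun=> setT) => //; rewrite eqEsubset; split.
- by rewrite bigcup_const//; exists 0%N.
- move=> _ _ [A mA ->] [A' mA' ->]; exists (fun i => A i `&` A' i).
    by move=> i; exact: measurableI.
  rewrite eqEsubset; split=> w /=; first by move=> [h h'] i ih; split; auto.
  by move=> h; split=> i /h[].
- move=> _ [A mA ->]; rewrite [RHS]m2E /m1 /mrestr/=.
  (* Putting [B] at index [n.+1] yields a product event one coordinate longer; independence is used
     for the first [n.+2] indices and for the first [n.+1]. *)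
  pose A' i := if (i <= n)%N then A i else B.
  have mA' i : measurable (A' i) by rewrite /A'; case: ifP.
  have := ind (iota 0 n.+2) A' (iota_uniq _ _) mA'.
  have := ind (iota 0 n.+1) A' (iota_uniq _ _) mA'.
  rewrite -[in X in _ -> X -> _](addn1 n.+1) iotaD big_cat/= big_seq1 add0n => <-.
  rewrite /A' ltnn.
  have -> : [set w | forall i, i \in 0%N :: iota 1 n ->
     (if (i <= n)%N then A i else B) (xi i w)] =
     [set w | forall i, (i <= n)%N -> A i (xi i w)].
    rewrite eqEsubset; split=> w /= h i.
      by move=> ile; have := h i; rewrite ile; apply; rewrite -/(iota 0 n.+1) mem_iota.
    by rewrite -/(iota 0 n.+1) mem_iota add0n ltnS => /= ile; rewrite ile; exact: h.
  move=> <-; congr (P _).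
  rewrite eqEsubset; split=> w /=.
    move=> [h hB] i; rewrite -cat_cons -/(iota 0 n.+1) mem_cat mem_iota add0n ltnS inE.
    by case: (leqP i n) => [ile _|_ /= /eqP ->//]; exact: h.
  move=> h; split.
    move=> i ile; have := h i; rewrite ile; apply.
    by rewrite -cat_cons -/(iota 0 n.+1) mem_cat mem_iota add0n ltnS ile.
  have := h n.+1; rewrite ltnn; apply.
  by rewrite -cat_cons -/(iota 0 n.+1) mem_cat mem_iota add0n ltnS inE eqxx orbT.
- by move=> _; rewrite /m1 /= /mrestr setTI cE ltry.
Qed.

(* Independence of the past says that the map w |-> (w, xi_(n+1) w), with T given
   the sigma-algebra of the past, sends P to a product measure; then Fubini. *)
Lemma ge0_integral_past (xi : nat -> {RV P >-> R}) n
    (g : g_sigma_algebraType (cylinders xi n) * R -> \bar R) :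
  mutually_independent xi -> measurable_fun setT g -> (forall z, 0 <= g z)%E ->
  (\int[P]_w g (w, xi n.+1 w) =
   \int[P]_w \int[distribution P (xi n.+1)]_y g (w, y))%E.
Proof.
move=> ind mg g0.
pose G := g_sigma_algebraType (cylinders xi n).
have mid : measurable_fun setT (fun w : T => w : G).
  move=> _ A mA; rewrite setTI preimage_id.
  exact: (smallest_sub (@sigma_algebra_measurable _ T) (@measurable_cylinders xi n)).
pose Y : {mfun T >-> G} :=
  HB.pack (fun w : T => w : G) (isMeasurableFun.Build _ _ _ _ _ mid).
pose YX w : G * R := (w, xi n.+1 w).
have mYX : measurable_fun setT YX by apply/measurable_fun_pairP; split.
have -> : (\int[P]_w g (w, xi n.+1 w) = \int[pushforward P YX]_z g z)%E.
  by rewrite ge0_integral_pushforward.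
have := fubini_tonelli1 (m1 := distribution P Y)
  (m2 := distribution P (xi n.+1)) g mg g0.
rewrite /fubini_F ge0_integral_pushforward//; last first.
- by move=> y _; apply: integral_ge0.
- exact: measurable_fun_fubini_tonelli_F.
rewrite preimage_setT => <-.
apply: eq_measure_integral => A mA _.
have {}mA : measurable A by [].
apply/esym/product_measure_unique => // B C mB mC /=.
rewrite /distribution /pushforward /= -past_indep//.
Qed.

Lemma sigma_cylinders_measurable (xi : nat -> {RV P >-> R}) n :
  <<s cylinders xi n>> `<=` measurable.
Proof.
exact: (smallest_sub (@sigma_algebra_measurable _ T) (@measurable_cylinders xi n)).
Qed.

Lemma measurable_past (xi : nat -> {RV P >-> R}) n i : (i <= n)%N ->
  measurable_fun setT (fun w : g_sigma_algebraType (cylinders xi n) => xi i w).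
Proof.
move=> ile _ B mB; rewrite setTI; apply: sub_sigma_algebra.
exists (fun j => if j == i then B else setT) => [j|]; first by case: ifP.
rewrite eqEsubset; split=> w /=; last by move=> /(_ i ile); rewrite eqxx.
by move=> h j jle; case: eqP => // ->.
Qed.

(** The density gives the law on sets only; identifying the law with the uniform probability measure
    gives access to integrals of functions. *)
Lemma ge0_integral_uniform_law (a b : R) (X : {RV P >-> R}) (f : R -> \bar R) :
  0 < a -> 0 < b -> has_density X (phi a b) ->
  measurable_fun setT f -> (forall x, 0 <= f x)%E ->
  (\int[distribution P X]_x f x =
   ((a + b)^-1)%R%:E * \int[lebesgue_measure]_(x in `](- a)%R, b[) f x)%E.
Proof.
move=> a0 b0 hX mf f0.
have ab : - a < b by rewrite (lt_trans _ b0)// oppr_lt0.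
pose GR := measurableTypeR R.
have mid : measurable_fun setT (fun x : GR => x : R) by [].
(* The Borel sigma-algebras of R and of measurableTypeR R coincide but have
   different displays; the identity transports measures between the two. *)
pose idTR : {mfun GR >-> R} :=
  HB.pack (fun x : GR => x : R) (isMeasurableFun.Build _ _ _ _ _ mid).
transitivity (\int[distribution (uniform_prob ab) idTR]_x f x)%E; last first.
  rewrite ge0_integral_distribution// integral_uniform// opprK addrC.
  rewrite integral_itv_bndoo//; exact: measurable_funTS.
apply: eq_measure_integral => A mA _.
transitivity (\int[lebesgue_measure]_(x in A) (phi a b x)%:E)%E; first exact: hX.
transitivity (uniform_prob ab A); last by [].
rewrite /uniform_prob integral_uniform_pdf [RHS]integral_mkcondl/=.
(* The density [uniform_pdf] lives on the closed interval and [phi] on the open one; the two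
   endpoints are dropped as a null set. *)
rewrite [RHS]integral_itv_bndoo; last first.
  apply: measurable_funTS; apply/(measurable_restrictT _ _).1 => //.
  apply: measurable_funTS; apply/measurable_EFinP.
  exact: measurable_uniform_pdf.
rewrite -[RHS]integral_mkcondl.
rewrite [LHS]integral_mkcond [RHS]integral_mkcond.
apply: eq_integral => x _; rewrite !patchE /phi /uniform_pdf in_setI.
have [xA|//] := boolP (x \in A).
case: ifPn => /=.
  rewrite inE/= in_itv/= => /andP[xa xb].
  rewrite (ltW xa) (ltW xb)/= indicE mem_set/=; last by rewrite in_itv/= xa xb.
  by rewrite mulr1 opprK [b + a]addrC.
by rewrite indicE => /negbTE ->; rewrite mulr0.
Qed.

(** Both [E] and [xi n] are determined by the past at time [n], so they can be frozen while
    [xi n.+1] is integrated against its own law. *)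
Lemma ge0_integral_past_uniform (a b : R) (xi : nat -> {RV P >-> R}) n
    (E : set T) (h : R * R -> \bar R) :
  0 < a -> 0 < b -> iid_with_density xi (phi a b) ->
  <<s cylinders xi n>> E -> measurable_fun setT h -> (forall z, 0 <= h z)%E ->
  (\int[P]_(w in E) h (xi n w, xi n.+1 w) =
   \int[P]_(w in E) (((a + b)^-1)%R%:E *
      \int[lebesgue_measure]_(y in `](- a)%R, b[) h (xi n w, y)))%E.
Proof.
move=> a0 b0 [ind dens] sE mh h0.
pose G := g_sigma_algebraType (cylinders xi n).
(* The event [E] is moved into the integrand as an indicator, since [ge0_integral_past] integrates
   over the whole space. *)
pose g (z : G * R) := ((\1_(E : set G) z.1)%:E * h (xi n z.1, z.2))%E.
have mg : measurable_fun setT g.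
  apply: emeasurable_funM.
    apply/measurable_EFinP.
    apply: (measurableT_comp (f := \1_E : G -> R)); last exact: measurable_fst.
    by apply: measurable_indic; exact: sE.
  apply: (measurableT_comp mh); apply/measurable_fun_pairP; split.
    apply: (measurableT_comp (f := fun w : G => xi n w)); last exact: measurable_fst.
    exact: measurable_past.
  exact: measurable_snd.
have g0 z : (0 <= g z)%E by rewrite mule_ge0// lee_fin.
rewrite [LHS]integral_mkcond [RHS]integral_mkcond.
transitivity (\int[P]_w g (w, xi n.+1 w))%E.
  apply: eq_integral => w _; rewrite patchE /g/= indicE.
  by case: ifPn => _; rewrite (mul0e, mul1e).
rewrite ge0_integral_past//; apply: eq_integral => w _.
rewrite patchE /g/= indicE; case: ifPn => wE; last first.
  by rewrite integral0_eq// => y _; rewrite mul0e.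
under eq_integral do rewrite mul1e.
rewrite (ge0_integral_uniform_law a0 b0)//.
exact: (measurableT_comp mh (measurable_pair1 _)).
Qed.
End innovations.

(** * Exponential rates from geometric bounds *)

Lemma cvg_ln_geometric_root (R : realType) (lam C : R) : 0 < lam -> 0 < C ->
  n%:R^-1 * ln (C * lam ^+ n) @[n --> \oo] --> ln lam.
Proof.
move=> l0 C0.
(* The sequence expanded, which is legitimate for [0 < n]; the constant contributes [ln C / n] and
   disappears in the limit. *)
have : n%:R^-1 * ln C + ln lam @[n --> \oo] --> 0 * ln C + ln lam.
  apply: cvgD; last exact: cvg_cst.
  apply: cvgMr_tmp.
  (* The harmonic sequence has general term [1 / (n + 1)], hence the shift of index. *)
  rewrite -(cvg_shiftS (fun n => n%:R^-1 : R)); exact: cvg_harmonic.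
rewrite mul0r add0r; apply: cvg_trans; apply: near_eq_cvg; near=> n.
have n0 : (0 < n)%N by near: n; exists 1%N.
rewrite lnM ?posrE ?exprn_gt0// lnXn// mulrDr -[ln lam *+ n]mulr_natl mulKf//.
by rewrite pnatr_eq0 -lt0n.
Unshelve. all: by end_near. Qed.

Lemma exponential_rate_squeeze (R : realType) (p : nat -> R) (lam C D : R) :
  0 < lam < 1 -> 0 < C -> 0 < D ->
  (forall n, C * lam ^+ n <= p n <= D * lam ^+ n) -> exponential_rate p lam.
Proof.
move=> /andP[l0 l1] C0 D0 CpD; split; first by rewrite l0.
apply: (@squeeze_cvgr _ _ _ _ (fun n => n%:R^-1 * ln (C * lam ^+ n))
  (fun n => n%:R^-1 * ln (D * lam ^+ n))); last 2 first.
- exact: cvg_ln_geometric_root.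
- exact: cvg_ln_geometric_root.
near=> n; have /andP[Cp pD] := CpD n.
have Cn : 0 < C * lam ^+ n by rewrite mulr_gt0// exprn_gt0.
rewrite !ler_wpM2l ?invr_ge0 ?ler_ln// ?posrE ?(lt_le_trans Cn)// .
by rewrite (le_trans Cp).
Unshelve. all: by end_near. Qed.

Lemma running_min_ge0 (T : Type) (R : realType) (Z : nat -> T -> R) n w :
  (0 <= running_min Z n w) <-> (forall i, (i <= n)%N -> 0 <= Z i w).
Proof.
split=> [h i ile|h].
  have il : (i < n.+1)%N by [].
  apply: (le_trans h); exact: (bigmin_le _ (Ordinal il)).
apply: le_bigmin => [|i _]; first exact: h.
by apply: h; rewrite -ltnS.
Qed.

(** * The transcendental equation of the case [a < b] *)

(** With [k = (b - a) / a] this is the boundary condition for [m = a] and [c = t / a]. Intermediate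
    values on [[0, pi / 4]]: left side minus right side is 1 at 0, and at [pi / 4] the left side
    vanishes while the right side is nonnegative. *)
Lemma eigen_root (R : realType) (k : R) : 0 < k ->
  exists t : R, [/\ 0 < t, t <= pi / 4 &
     cos t - sin t = t * k * (cos t + sin t)].
Proof.
move=> k0; have p0 := pi_gt0 R.
pose g t : R := cos t - sin t - t * k * (cos t + sin t).
have cg : continuous g.
  move=> t; apply: (@continuousB _ R^o R^o (fun t => cos t - sin t)).
    by apply: (@continuousB _ R^o R^o (@cos R)); [exact: continuous_cos|exact: continuous_sin].
  apply: (@continuousM _ R^o (fun t => t * k) (fun t => cos t + sin t)).
    exact: mulrr_continuous.
  by apply: (@continuousD _ R^o R^o (@cos R)); [exact: continuous_cos|exact: continuous_sin].
have g0 : g 0 = 1 by rewrite /g cos0 sin0 !mul0r !subr0.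
have s0 : 0 < sin (pi / 4) :> R by apply: sin_gt0_pi; apply/andP; split; lra.
have g1 : g (pi / 4) <= 0.
  rewrite /g cos_piquarter subrr sub0r oppr_le0; apply: mulr_ge0; last by rewrite addr_ge0// ltW.
  by apply: mulr_ge0; [lra|exact: ltW].
have p40 : 0 <= pi / 4 :> R by lra.
have [|t] := @IVT R g 0 (pi / 4) 0 p40 (continuous_subspaceT cg).
  by rewrite ge_min le_max g0 g1 ler01 orbT.
rewrite in_itv/= => /andP[t0 t4] gt0; exists t; split => //.
  rewrite lt_neqAle t0 andbT; apply/eqP => t0E; move: gt0.
  by rewrite -t0E g0 => /eqP; rewrite oner_eq0.
by apply/eqP; rewrite -subr_eq0; apply/eqP.
Qed.

(** In the variable [s = a / ((a + b) * mu)] and with [k = (b - a) / a], the equation reads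
    [tan s = (1 - k * s) / (1 + k * s)]. A solution [mu] above the given one has [0 < s < t]; there
    the tangent increases and the right side decreases, while they agree at [t]. *)
Lemma largest_eigen_solution_root (R : realType) (a b t : R) :
  0 < a -> a < b -> 0 < t -> t <= pi / 4 ->
  cos t - sin t = t * ((b - a) / a) * (cos t + sin t) ->
  largest_eigen_solution a b (a / ((a + b) * t)).
Proof.
move=> a0 ab t0 t4 ht; have p0 := pi_gt0 R.
have b0 : 0 < b by lra.
have ab0 : 0 < a + b by lra.
pose k := (b - a) / a.
have k0 : 0 < k by rewrite divr_gt0//; lra.
have rE mu : mu != 0 -> (1 - 2 * a / (a + b)) / mu = k * (a / ((a + b) * mu)).
  by move=> mu0; rewrite /k; field; rewrite mu0 (gt_eqF a0) (gt_eqF ab0).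
pose lam := a / ((a + b) * t).
have lam0 : 0 < lam by rewrite divr_gt0// mulr_gt0.
have tE : a / ((a + b) * lam) = t.
  by rewrite /lam; field; rewrite (gt_eqF a0) (gt_eqF ab0) (gt_eqF t0).
have ct : 0 < cos t by apply: cos_gt0_pihalf; apply/andP; split; lra.
have kt : 0 < k * t by rewrite mulr_gt0.
have tant : tan t = (1 - k * t) / (1 + k * t).
  have kt1 : 1 + k * t != 0 by rewrite gt_eqF// addr_gt0.
  apply/eqP; rewrite /tan eqr_div ?(gt_eqF ct)//; apply/eqP.
  move: ht; rewrite -/k; lra.
split.
  split; rewrite ?gt_eqF// ?rE ?gt_eqF// ?tE//.
  by rewrite addr_gt0.
move=> mu [mu0 cmu rmu]; rewrite !rE// => tanmu.
rewrite -/lam leNgt; apply/negP => lammu.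
have mu1 : 0 < mu by rewrite (lt_trans lam0).
pose s := a / ((a + b) * mu).
have s0 : 0 < s by rewrite divr_gt0// mulr_gt0.
have st : s < t.
  rewrite /s -tE ltr_pM2l// ltf_pV2 ?posrE; last 2 first.
  - exact: mulr_gt0.
  - exact: mulr_gt0.
  by rewrite ltr_pM2l.
have : tan s < tan t.
  by rewrite ltr_tan// in_itv/=; apply/andP; split; lra.
rewrite tant tanmu -/s; apply/negP; rewrite -leNgt.
have ks : 0 < k * s by rewrite mulr_gt0.
have kst : k * s < k * t by rewrite ltr_pM2l.
rewrite ler_pdivrMr ?addr_gt0// [leRHS]mulrAC ler_pdivlMr ?addr_gt0//.
nra.
Qed.

(** * Survival events and eigenfunction weights *)

Section survival.
Context (R : realType) (d : measure_display) (T : measurableType d).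
Context (P : probability T R) (xi : nat -> {RV P >-> R}) (a b : R).

(** As [ma1 xi i] involves [xi i.+1], the bound [i < n] keeps the event in the past at time [n]. The
    first constraint, almost sure for the density [phi a b], puts [xi n] where the eigenvalue
    equation holds. *)
Definition survival (n : nat) : set T :=
  [set w | (forall i, (i <= n)%N -> - a < xi i w < b) /\
           (forall i, (i < n)%N -> 0 <= ma1 xi i w)].

Lemma survivalS n : survival n.+1 = survival n `&`
  [set w | (- a < xi n.+1 w < b) /\ 0 <= xi n w + xi n.+1 w].
Proof.
rewrite eqEsubset; split=> w /=.
  move=> [hI hZ]; split; last by split; [exact: hI|rewrite addrC; exact: hZ].
  by split=> i ile; [apply: hI; exact: leqW|apply: hZ; exact: leqW].
move=> [[hI hZ] [hI' hZ']]; split=> i.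
  by rewrite leq_eqVlt => /predU1P[->//|]; exact: hI.
rewrite ltnS leq_eqVlt => /predU1P[->|]; last exact: hZ.
by rewrite /ma1 addrC.
Qed.

Lemma survival_past n : <<s cylinders xi n>> (survival n).
Proof.
pose G := g_sigma_algebraType (cylinders xi n).
have -> : survival n = (\bigcap_(i in `I_n.+1) (xi i @^-1` `](- a), b[)) `&`
    (\bigcap_(i in `I_n) (ma1 xi i @^-1` `[0, +oo[)).
  rewrite eqEsubset; split=> w /= [hI hZ]; split=> i /= ile.
  - exact: hI.
  - by rewrite in_itv/= andbT; exact: hZ.
  - exact: hI.
  - by have := hZ i ile; rewrite /= in_itv/= andbT.
suff : measurable ((\bigcap_(i in `I_n.+1) (xi i @^-1` `](- a), b[)) `&`
    (\bigcap_(i in `I_n) (ma1 xi i @^-1` `[0, +oo[)) : set G) by [].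
have mpre (X : G -> R) (A : set R) : measurable_fun setT X -> measurable A ->
  measurable (X @^-1` A) by move=> mX mA; rewrite -[_ @^-1` _]setTI; exact: mX.
apply: measurableI.
  apply: fin_bigcap_measurable => // i ile; apply: mpre => //.
  exact: measurable_past.
apply: fin_bigcap_measurable => // i ile; apply: mpre => //.
by apply: measurable_funD; apply: measurable_past => //; exact: ltnW.
Qed.

Lemma measurable_survival n : measurable (survival n).
Proof. by have := @survival_past n; exact: sigma_cylinders_measurable. Qed.

Lemma survival_itv n w : survival n w -> - a < xi n w < b.
Proof. by case=> + _; exact. Qed.

Lemma integral_survivalS (f : R -> R) n : 0 < a -> 0 < b ->
  iid_with_density xi (phi a b) -> measurable_fun setT f -> (forall y, 0 <= f y) ->
  (\int[P]_(w in survival n.+1) (f (xi n.+1 w))%:E =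
   \int[P]_(w in survival n) (((a + b)^-1)%R%:E *
     \int[lebesgue_measure]_(y in `](- a)%R, b[)
       (\1_(`[0%R, +oo[ : set R) (xi n w + y) * f y)%:E))%E.
Proof.
move=> a0 b0 xi_iid mf f0.
pose I : set R := `](- a), b[%classic.
pose J : set R := `[0, +oo[%classic.
(* The two indicators encode exactly the constraints that [survivalS] adds, so the integral over
   [survival n.+1] becomes one over the past event [survival n]. *)
pose h (z : R * R) := (\1_I z.2 * (\1_J (z.1 + z.2) * f z.2))%:E.
have mh : measurable_fun setT h.
  apply/measurable_EFinP; apply: measurable_funM.
    apply: (measurableT_comp (f := \1_I : R -> R)) => //.
    by apply: measurable_indic; exact: measurable_itv.
  apply: measurable_funM.
    apply: (measurableT_comp (f := \1_J : R -> R)).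
      by apply: measurable_indic; exact: measurable_itv.
    exact: measurable_funD.
  exact: measurableT_comp.
have h0 z : (0 <= h z)%E by rewrite lee_fin !mulr_ge0.
transitivity (\int[P]_(w in survival n) h (xi n w, xi n.+1 w))%E.
  rewrite survivalS [LHS]integral_mkcondr; apply: eq_integral => w _.
  rewrite patchE /h/= !indicE; case: ifPn.
    rewrite inE/= => -[xI xJ].
    have -> : xi n.+1 w \in I by rewrite inE/I/= in_itv.
    have -> : xi n w + xi n.+1 w \in J by rewrite inE/J/= in_itv/= xJ.
    by rewrite !mul1r.
  rewrite notin_setE/= => /not_andP nxIJ.
  case: (boolP (_ \in I)) => [|_]; last by rewrite mul0r.
  case: (boolP (_ \in J)) => [|_]; last by rewrite mul0r mulr0.
  by rewrite !inE /I /J/= !in_itv/= andbT => xJ xI; case: nxIJ.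
rewrite (ge0_integral_past_uniform a0 b0 xi_iid (@survival_past n) mh h0).
apply: eq_integral => w _; congr (_ * _)%E; apply: eq_integral => y yI.
by rewrite /h/= indicE yI mul1r.
Qed.

Context (c m : R).
Let M n := (\int[P]_(w in survival n) (eigf c m (xi n w))%:E)%E.

Lemma survival_weight_le n : 0 < c -> 0 < m -> c * m <= pi / 4 ->
  (M n <= 2%:E * P (survival n))%E.
Proof.
move=> c0 m0 cm; rewrite -integral_cst; last exact: measurable_survival.
apply: ge0_le_integral => //.
- exact: measurable_survival.
- by move=> w _; rewrite lee_fin eigf_ge0.
- apply/measurable_EFinP/measurable_funTS/measurableT_comp => //.
  exact: measurable_eigf.
- by move=> w _; rewrite lee_fin eigf_le2.
Qed.

Hypotheses (a0 : 0 < a) (b0 : 0 < b) (c0 : 0 < c) (m0 : 0 < m).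
Hypothesis cm : c * m <= pi / 4.
Hypotheses (ma : m <= a) (mb : m <= b) (mE : m = a \/ m = b).
Hypothesis bnd : trig_sum c (- m) = c * (b - m) * trig_sum c m.
Hypothesis xi_iid : iid_with_density xi (phi a b).

(** Conditioning on the past applies the operator to [eigf] at [xi n], and [survival n] ensures that
    [xi n] lies in [(- a, b)], as [eigf_integral] requires. *)
Lemma survival_weightS n : (M n.+1 = (((a + b) * c)^-1)%:E * M n)%E.
Proof.
rewrite /M integral_survivalS//; last 2 first.
- exact: measurable_eigf.
- by move=> y; exact: eigf_ge0.
rewrite -ge0_integralZl//=; last 4 first.
- exact: measurable_survival.
- apply/measurable_EFinP/measurable_funTS/measurableT_comp => //.
  exact: measurable_eigf.
- by move=> w _; rewrite lee_fin eigf_ge0.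
- by rewrite lee_fin invr_ge0 mulr_ge0 ?addr_ge0 ?ltW.
apply: eq_integral => w; rewrite inE => /survival_itv wI.
rewrite (eigf_integral c0 m0 cm ma mb mE bnd wI) -!EFinM; congr EFin.
by field; rewrite !gt_eqF ?addr_gt0.
Qed.

Let mfxi n k : measurable_fun (survival n) (fun w => (eigf c m (xi k w))%:E).
Proof.
apply/measurable_EFinP/measurable_funTS/measurableT_comp => //.
exact: measurable_eigf.
Qed.

Let fxi0 w k : (0 <= (eigf c m (xi k w))%:E)%E.
Proof. by rewrite lee_fin eigf_ge0. Qed.

Lemma le_survivalS_weight n : (P (survival n.+1) <= M n.+1 + M n)%E.
Proof.
have mS := @measurable_survival.
have sS : survival n.+1 `<=` survival n by rewrite survivalS => w [].
apply: (@le_trans _ _ (\int[P]_(w in survival n.+1)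
  ((eigf c m (xi n.+1 w))%:E + (eigf c m (xi n w))%:E)))%E.
  rewrite -[leLHS]mul1e -integral_cst//.
  apply: ge0_le_integral => //.
    by apply: emeasurable_funD.
  rewrite survivalS => w [_ /= [_ Z0]].
  rewrite -EFinD lee_fin; have [x0|x0] := leP 0 (xi n.+1 w).
    by rewrite (le_trans (eigf_ge1 c0 m0 cm x0))// lerDl eigf_ge0.
  have x0' : 0 <= xi n w by lra.
  by rewrite (le_trans (eigf_ge1 c0 m0 cm x0'))// lerDr eigf_ge0.
(* The second term is so far integrated over [survival n.+1]; being nonnegative, it grows when the
   domain is enlarged to [survival n]. *)
rewrite ge0_integralD//; apply: leeD => //.
exact: ge0_subset_integral.
Qed.

(** This makes the lower bound nontrivial. Restricting the integral of [eigf] to nonnegative [y]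
    gives the eigenvalue equation at [x = 0], with value [eigf 0 / c], and [eigf 0] is at least
    1. *)
Lemma survival_weight0_ge : ((((a + b) * c)^-1)%:E <= M 0)%E.
Proof.
pose I : set R := `](- a), b[%classic.
have mg : measurable_fun setT (fun y => (\1_I y * eigf c m y)%:E).
  apply/measurable_EFinP/measurable_funM; last exact: measurable_eigf.
  by apply: measurable_indic; exact: measurable_itv.
have -> : (M 0 = \int[distribution P (xi 0)]_y (\1_I y * eigf c m y)%:E)%E.
  rewrite ge0_integral_distribution//; last first.
    by move=> y; rewrite lee_fin mulr_ge0// eigf_ge0.
  rewrite /M integral_mkcond; apply: eq_integral => w _; rewrite patchE /=.
  have -> : (w \in survival 0) = (xi 0 w \in I).
    apply/idP/idP; rewrite !inE /I/= in_itv/=; first by case=> /(_ 0%N) + _; exact.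
    by move=> h; split=> // -[].
  by rewrite indicE; case: ifPn => _; rewrite (mul0r, mul1r).
rewrite (ge0_integral_uniform_law a0 b0 (xi_iid.2 0%N))//; last first.
  by move=> y; rewrite lee_fin mulr_ge0// eigf_ge0.
have abc0 : - a < 0 < b by rewrite oppr_lt0 a0.
apply: (@le_trans _ _ (((a + b)^-1)%:E * (eigf c m 0 / c)%:E))%E.
  rewrite -EFinM lee_fin invfM ler_pM2l ?invr_gt0 ?addr_gt0//.
  by rewrite ler_peMl ?invr_ge0 ?(ltW c0)// eigf_ge1.
rewrite lee_pmul2l ?lte_fin ?invr_gt0 ?addr_gt0//.
rewrite -(eigf_integral c0 m0 cm ma mb mE bnd abc0).
apply: ge0_le_integral => //.
- by move=> y _; rewrite lee_fin mulr_ge0// eigf_ge0.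
- apply/measurable_EFinP/measurable_funTS/measurable_funM; last exact: measurable_eigf.
  apply: (measurableT_comp (f := \1_(`[0, +oo[ : set R) : R -> R)).
    by apply: measurable_indic; exact: measurable_itv.
  exact: measurable_funD.
- exact: measurable_funTS.
- move=> y yI; rewrite lee_fin ler_wpM2r ?eigf_ge0// !indicE add0r.
  by rewrite [y \in I]mem_set// lern1 leq_b1.
Qed.

Lemma survival_weightE n : (M n = ((((a + b) * c)^-1) ^+ n)%:E * M 0)%E.
Proof.
elim: n => [|n IHn]; first by rewrite expr0 mul1e.
by rewrite survival_weightS IHn muleA -EFinM -exprS.
Qed.

(** The index is shifted because [ma1 xi 0], ..., [ma1 xi n] involve [xi 0], ..., [xi n.+1]. The two
    events differ only inside the null event [N] that some innovation leaves [(- a, b)]. *)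
Lemma persistence_probE n : persistence_prob xi n = fine (P (survival n.+1)).
Proof.
congr fine.
pose N := \bigcup_i (xi i @^-1` ~` `](- a), b[%classic).
have mN i : measurable (xi i @^-1` ~` `](- a), b[%classic).
  by apply: measurable_rv_preimage; exact: measurableC.
have N0 : P N = 0.
  apply/negligibleP; first exact: bigcup_measurable.
  apply: negligible_bigcup => i; apply/negligibleP => //.
  transitivity (distribution P (xi i) (~` `](- a), b[%classic)); first by [].
  rewrite (xi_iid.2 i)//; last exact: measurableC.
  apply: integral0_eq => x /= nx; rewrite /phi indicE memNset//.
  by rewrite mulr0.
have mE' : measurable [set w | 0 <= running_min (ma1 xi) n w].
  have -> : [set w | 0 <= running_min (ma1 xi) n w] =
     \bigcap_(i in `I_n.+1) (ma1 xi i @^-1` `[0, +oo[).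
    rewrite eqEsubset; split=> w /=.
      by move=> /running_min_ge0 h i /= ile; rewrite in_itv/= andbT; exact: h.
    move=> h; apply/running_min_ge0 => i ile.
    by have := h i ile; rewrite /= in_itv/= andbT.
  apply: fin_bigcap_measurable => // i _; rewrite -[X in measurable X]setTI.
  have mZ : measurable_fun setT (ma1 xi i) by exact: measurable_funD.
  exact: mZ.
apply/eqP; rewrite eq_le; apply/andP; split; last first.
  apply: le_measure; rewrite ?inE//; first exact: measurable_survival.
  by move=> w [_ hZ]; apply/running_min_ge0.
rewrite -(measureU0 (measurable_survival n.+1) _ N0); last exact: bigcup_measurable.
apply: le_measure; rewrite ?inE//.
  by apply: measurableU; [exact: measurable_survival|exact: bigcup_measurable].
move=> w /= /running_min_ge0 hZ.
have [[i nI]|nN] := pselect (exists i, ~ (- a < xi i w < b)).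
  by right; exists i => //=; rewrite in_itv.
left; split=> // i _; apply: contrapT => nI; apply: nN; by exists i.
Qed.

End survival.

(** * From the boundary condition to the persistence rate *)

(** Common to both regimes, which differ only in the choice of [m] and [c]. *)
Lemma exponential_rate_persistence (R : realType) (d : measure_display)
    (T : measurableType d) (P : probability T R) (xi : nat -> {RV P >-> R})
    (a b c m : R) : 0 < a -> 0 < b -> 0 < c -> 0 < m -> c * m <= pi / 4 ->
  m <= a -> m <= b -> m = a \/ m = b ->
  trig_sum c (- m) = c * (b - m) * trig_sum c m ->
  iid_with_density xi (phi a b) ->
  exponential_rate (persistence_prob xi) ((a + b) * c)^-1.
Proof.
move=> a0 b0 c0 m0 cm ma mb mE bnd xi_iid.
pose M n := (\int[P]_(w in survival xi a b n) (eigf c m (xi n w))%:E)%E.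
pose lam := ((a + b) * c)^-1.
have ab0 : 0 < a + b by rewrite addr_gt0.
have l0 : 0 < lam by rewrite invr_gt0 mulr_gt0.
have l1 : lam < 1.
  rewrite invf_lt1 ?mulr_gt0// mulrC.
  by rewrite (lt_le_trans (eigenvalue_lt1 c0 m0 cm bnd))// ler_pM2l//; lra.
have M2 n : (M n <= 2%:E * P (survival xi a b n))%E by exact: survival_weight_le.
(* Finiteness follows from [eigf <= 2]. *)
have M0fin : M 0%N \is a fin_num.
  rewrite ge0_fin_numE; last by apply: integral_ge0 => w _; rewrite lee_fin eigf_ge0.
  rewrite (le_lt_trans (M2 0%N))// -ge0_fin_numE ?mule_ge0// fin_numM//.
  by rewrite fin_num_measure//; exact: measurable_survival.
pose r := fine (M 0%N).
have rE : M 0%N = r%:E by rewrite fineK.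
have r0 : 0 < r.
  rewrite (lt_le_trans l0)// -lee_fin -rE.
  exact: (survival_weight0_ge a0 b0 c0 m0 cm ma mb mE bnd xi_iid).
have ME n : M n = (lam ^+ n * r)%:E.
  rewrite /M (survival_weightE a0 b0 c0 m0 cm ma mb mE bnd xi_iid).
  by rewrite -/(M 0%N) rE EFinM.
(* Since [M n = lam ^+ n * r], these constants come from the lower bound [M n.+1 / 2] and the upper
   bound [M n.+1 + M n] for the probability of [survival n.+1]. *)
apply: (@exponential_rate_squeeze _ _ _ (lam * r / 2) ((1 + lam) * r)).
- by rewrite l0.
- by rewrite !mulr_gt0.
- by rewrite mulr_gt0// addr_gt0.
move=> n; rewrite (persistence_probE xi_iid).
set p := P _.
have pE : p = (fine p)%:E.
  by rewrite fineK// fin_num_measure//; exact: measurable_survival.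
have := @le_survivalS_weight _ _ _ P xi a b c m c0 m0 cm n.
have := M2 n.+1; rewrite -/(M n) -/(M n.+1) -/p !ME pE -EFinM -EFinD !lee_fin exprS.
set q := lam ^+ n => h1 h2; apply/andP; split; nra.
Qed.

Theorem proposition3p1 (R : realType) (d : measure_display)
    (T : measurableType d) (P : probability T R)
    (a b : R) (a_gt0 : 0 < a) (b_gt0 : 0 < b)
    (xi : nat -> {RV P >-> R}) (xi_iid : iid_with_density xi (phi a b)) :
  (b <= a ->
     exponential_rate (persistence_prob xi) (4 * b / (pi * (a + b)))) /\
  (a < b ->
     exists lambda : R, largest_eigen_solution a b lambda /\
       exponential_rate (persistence_prob xi) lambda).
Proof.
have p0 := pi_gt0 R; split => [ba|ab].
  (* For [m = b] the boundary condition becomes [cos (c * b) = sin (c * b)], solved by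
     [c = pi / (4 * b)]. *)
  have -> : 4 * b / (pi * (a + b)) = ((a + b) * (pi / (4 * b)))^-1.
    move: (pi : R) p0 => p p0.
    by field; rewrite !gt_eqF ?addr_gt0.
  have cb : pi / (4 * b) * b = pi / 4 by field; rewrite gt_eqF.
  apply: (exponential_rate_persistence (m := b)) => //.
  - by rewrite divr_gt0// mulr_gt0.
  - by rewrite cb.
  - by right.
  - by rewrite subrr mulr0 mul0r /trig_sum mulrN cb cosN sinN cos_piquarter subrr.
have ba0 : 0 < b - a by lra.
have [t [t0 t4 ht]] := eigen_root (divr_gt0 ba0 a_gt0).
exists (a / ((a + b) * t)); split; first exact: largest_eigen_solution_root.
(* Here [m = a] and [c = t / a], so that [c * m] is the root [t]. *)
have -> : a / ((a + b) * t) = ((a + b) * (t / a))^-1.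
  by field; rewrite !gt_eqF ?addr_gt0.
have ca : t / a * a = t by rewrite divfK// gt_eqF.
apply: (exponential_rate_persistence (m := a)) => //.
- exact: divr_gt0.
- by rewrite ca.
- exact: ltW.
- by left.
- by rewrite /trig_sum mulrN ca cosN sinN ht; congr (_ * _); field; rewrite gt_eqF.
Qed.
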